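(* Let $\kappa$ be an infinite cardinal. If $X$ is a compact Hausdorff space with tightness $\mathrm{t}(X)\leq\kappa$ and $Y$ is a Tychonoff space with boundary tightness $\mathrm{tb}(Y)\leq\kappa$, then the product space $X\times Y$ has boundary tightness $\mathrm{tb}(X\times Y)\leq\kappa$.
   Context: All spaces are Tychonoff topological spaces (completely regular and Hausdorff); in particular compact spaces are Hausdorff. For an infinite cardinal $\kappa$, a space $X$ and a subset $A\subset X$, the $\kappa$-closure of $A$ in $X$ is $$\overline{A}^{\kappa}=\bigcup\{\overline{B}\colon B\subset A \text{ and } |B|\leq\kappa\}.$$ The tightness of $X$ is the cardinal $$\mathrm{t}(X)=\min\{\kappa\colon \kappa \text{ is an infinite cardinal and } \overline{A}=\overline{A}^{\kappa} \text{ for every } A\subset X\}.$$ The boundary tightness of $X$ is the cardinal $$\mathrm{tb}(X)=\min\{\kappa\colon \kappa \text{ is an infinite cardinal and } \overline{U}=\overline{U}^{\kappa} \text{ for every open } U\subset X\}.$$ *)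

(* Defs.v *)
From HB Require Import structures.
From mathcomp Require Import all_boot all_order all_algebra.
From mathcomp Require Import all_classical all_reals all_analysis.

Set Implicit Arguments.
Unset Strict Implicit.
Unset Printing Implicit Defensive.

Local Open Scope classical_set_scope.
Local Open Scope card_scope.

(* A cardinal is represented by any type [K] of that cardinality. All notions
   below depend on [K] only up to equipotence. *)

(* [closure] on the right-hand side is taken in the whole space. *)
Definition card_closure (K : Type) (X : topologicalType) (A : set X) : set X :=
  [set x | exists B : set X, [/\ B `<=` A, B #<= [set: K] & closure B x]].

(* The cardinal of [t] is the minimum of the infinite cardinals satisfying
   [P]; it is unique up to equipotence. *)
Definition is_min_infinite_cardinal (P : Type -> Prop) (t : Type) : Prop :=
  [/\ infinite_set [set: t], P t &
      forall M : Type, infinite_set [set: M] -> P M -> [set: t] #<= [set: M]].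

Definition is_tightness (X : topologicalType) (t : Type) : Prop :=
  is_min_infinite_cardinal
    (fun K => forall A : set X, closure A = card_closure K A) t.

Definition is_boundary_tightness (X : topologicalType) (t : Type) : Prop :=
  is_min_infinite_cardinal
    (fun K => forall U : set X, open U -> closure U = card_closure K U) t.

Definition tightness_le (X : topologicalType) (K : Type) : Prop :=
  exists t : Type, is_tightness X t /\ [set: t] #<= [set: K].

Definition boundary_tightness_le (X : topologicalType) (K : Type) : Prop :=
  exists t : Type, is_boundary_tightness X t /\ [set: t] #<= [set: K].

(* [completely_regular_space] asks for a [uniform_separator] between a point
   and a closed set missing it; by [uniform_separatorP] this is the existence
   of a continuous function to [0, 1] equal to 0 at the point and to 1 on the
   closed set. *)
Definition tychonoff_space (X : topologicalType) : Prop :=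
  completely_regular_space X /\ hausdorff_space X.

(* Main.v *)
Require Import Defs.
From mathcomp Require Import all_boot all_order all_algebra.
From mathcomp Require Import all_classical all_reals all_analysis.

Local Open Scope classical_set_scope.
Local Open Scope card_scope.

(* Let [(x0, y0)] lie in the closure of the open set [U], and let [F] be the
   [K]-closure of [U]. Since K * K = K, [F] is [K]-closed, so that its slice [G]
   at [y0] is closed in [X]. If [x0] were not in [G], some neighbourhood [V] of
   [x0] would have closure disjoint from [G]. Now [y0] is in the closure of the
   projection of [U `&` (V° `*` setT)] to [Y], which is open, hence in the closure
   of a subset of it of size at most [K]. Lift that subset to [U]: as [X] is
   compact the projection is closed, so the closure of the lift contains some
   [(x, y0)], and then [x] is in [G] and in the closure of [V]. *)

(** * Comparison of cardinals *)

Lemma inj_card_leT (T U : Type) (f : T -> U) :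
  injective f -> [set: T] #<= [set: U].
Proof.
move=> finj; have -> : ([set: T] #<= [set: U]) = (f @` setT #<= [set: U]).
  by apply/esym/card_le_eql/inj_card_eq => x y _ _; exact: finj.
exact: card_leT.
Qed.

Lemma card_le_inj (T U : Type) (A : set T) (B : set U) (u0 : U) :
  A #<= B -> exists f : T -> U,
    (forall x, A x -> B (f x)) /\ (forall x y, A x -> A y -> f x = f y -> x = y).
Proof.
elim/Ppointed: U => U in B u0 *; first by have := no u0.
move=> /pcard_leP[f]; exists f; split; first by move=> x; exact: (@funS _ _ _ _ f).
by move=> x y Ax Ay; apply: (@inj _ _ _ f); rewrite inE.
Qed.

Lemma infinite_set_pair (T : Type) (A : set T) :
  infinite_set A -> exists a b, [/\ A a, A b & a <> b].
Proof.
move=> Ainf; have [a Aa] := infinite_setN0 Ainf.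
apply: contrapT => /forallNP h; apply: Ainf.
apply: (sub_finite_set _ (finite_set1 a)) => b Ab /=.
apply: contrapT => ba; apply: (h a); exists b; split=> // ab; exact: ba.
Qed.

(* Zorn's lemma for the subsets of the product on which all the projections are
   injective: in a maximal one, some projection is onto. *)
Lemma card_le_family_min (I : Type) (i0 : I) (T : I -> Type) :
  exists i, forall j, [set: T i] #<= [set: T j].
Proof.
pose P (S : set (forall i, T i)) :=
  forall s t i, S s -> S t -> s i = t i -> s = t.
have [F FP totF|S [PS Smax]] := @Zorn_bigcup _ P.
  move=> s t i [X FX Xs] [Y FY Yt].
  by have [XY|YX] := totF _ _ FX FY; [apply: (FP Y FY)|apply: (FP X FX)]; auto.
have [[i onto]|/forallNP nonto] :=
    pselect (exists i, forall x : T i, exists s, S s /\ s i = x).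
  (* A right inverse of the projection onto [T i], followed by the projection to [T j], is
     injective. *)
  exists i => j; have [g gP] := choice onto.
  apply: (@inj_card_leT _ _ (fun x => g x j)) => x y gxy.
  have [Sx <-] := gP x; have [Sy <-] := gP y.
  by rewrite (PS _ _ j Sx Sy gxy).
have {}nonto i : {x : T i | forall s, S s -> s i <> x}.
  apply: cid; apply: contrapT => /forallNP h; apply: (nonto i) => x.
  apply: contrapT => /forallNP g; apply: (h x) => s Ss sx; exact: (g s).
(* The missed values form a point that differs from each member of [S] in every coordinate, so
   adjoining it contradicts maximality. *)
pose x i := sval (nonto i); have xP i s : S s -> s i <> x i := svalP (nonto i) s.
case: (Smax (S `|` [set x])); first split.
- by left.
- by move/(_ x (or_intror erefl)) => Sx; exact: (xP i0 _ Sx).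
move=> s t i [Ss|->] [St|->] //; first exact: PS.
- by move=> /(xP i s Ss).
- by move=> /esym/(xP i t St).
Qed.

(** A family of two sets has a smallest member. *)
Lemma card_le_total (T U : Type) (A : set T) (B : set U) : A #<= B \/ B #<= A.
Proof.
have [[] le] :=
    card_le_family_min bool true (fun b => if b then set_type A else set_type B).
- left; rewrite -(card_le_eql (card_setT A)) -(card_le_eqr (card_setT B)).
  exact: (le false).
- right; rewrite -(card_le_eql (card_setT B)) -(card_le_eqr (card_setT A)).
  exact: (le true).
Qed.

(** * The square of an infinite cardinal *)

Section infinite_square.
Variable K : Type.
Hypothesis Kinf : infinite_set [set: K].

(** A pair [(S, f)] encodes an injection of the square of [S] into [S]. The function is total, but
    only its values on that square count. *)
Let valid (s : set K * (K * K -> K)) := 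
  [/\ infinite_set s.1,
      forall p, s.1 p.1 -> s.1 p.2 -> s.1 (s.2 p) &
      forall p q, s.1 p.1 -> s.1 p.2 -> s.1 q.1 -> s.1 q.2 ->
        s.2 p = s.2 q -> p = q].

Let extends (s t : set K * (K * K -> K)) :=
  s.1 `<=` t.1 /\ forall p, s.1 p.1 -> s.1 p.2 -> s.2 p = t.2 p.

Let valid_nonempty : exists s, valid s.
Proof.
have [k0 _] := infinite_setN0 Kinf.
have /(card_le_inj _ _ _ _ k0)[f [_ finj]] := (infiniteP _).1 Kinf.
have {}finj m n : f m = f n -> m = n by exact: finj.
have [r rK] : exists r : K -> nat, cancel f r.
  have : forall k, exists n, forall m, f m = k -> m = n.
    move=> k; have [[n fn]|nk] := pselect (exists n, f n = k).
      by exists n => m; rewrite -fn => /finj.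
    by exists 0%N => m fm; case: nk; exists m.
  by move=> /choice[r rP]; exists r => n; rewrite -(rP (f n) n).
(* The pairing [pickle] of natural numbers, transported to a countable subset of [K]. *)
exists (range f, fun p => f (pickle (r p.1, r p.2))); split => /=.
- apply/infiniteP; rewrite (card_le_eqr (inj_card_eq _)) // => m n _ _.
  exact: finj.
- by move=> p _ _; exists (pickle (r p.1, r p.2)).
- move=> [_ _] [_ _] /= [a _ <-] [b _ <-] [c _ <-] [d _ <-]; rewrite !rK.
  by move=> /finj/(pcan_inj pickleK)[-> ->].
Qed.

(** Zorn's lemma for a preorder: pairs that extend each other may still differ off the square. *)
Let valid_maximal :
  exists2 s, valid s & forall t, valid t -> extends s t -> t.1 `<=` s.1.
Proof.
have [s0 s0P] := valid_nonempty.
pose V := {s | valid s}.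
pose R (s t : V) := `[< extends (sval s) (sval t) >].
have [||A totA|m mmax] := @ZL_preorder V (exist _ s0 s0P) R.
- by move=> t; apply/asboolP; split.
- move=> r s t /asboolP[rs rs2] /asboolP[st st2]; apply/asboolP; split.
    exact: subset_trans st.
  by move=> p p1 p2; rewrite rs2// st2//; exact: rs.
- have [[s1 As1]|A0] := pselect (exists s, A s); last first.
    by exists (exist _ s0 s0P) => s As; case: A0; exists s.
  have totE s t : A s -> A t -> extends (sval s) (sval t) \/ extends (sval t) (sval s).
    by move=> As At; have [/asboolP|/asboolP] := totA _ _ As At; [left|right].
  (* Members of the chain agree wherever both are relevant, so they glue to one function [g]; [p.1]
     is a dummy value off all their squares. *)
  have : forall p, exists c, forall s, A s -> (sval s).1 p.1 -> (sval s).1 p.2 ->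
      (sval s).2 p = c.
    move=> p.
    have [[s [As p1 p2]]|no] :=
        pselect (exists s, [/\ A s, (sval s).1 p.1 & (sval s).1 p.2]); last first.
      by exists p.1 => s As p1 p2; case: no; exists s.
    exists ((sval s).2 p) => t At t1 t2.
    by have [[_ ->]|[_ ->]] := totE _ _ As At.
  move=> /choice[g gP].
  pose U := \bigcup_(s in A) (sval s).1.
  have U2 x y : U x -> U y -> exists s, [/\ A s, (sval s).1 x & (sval s).1 y].
    move=> [s As sx] [t At ty].
    by have [[st _]|[ts _]] := totE _ _ As At; [exists t|exists s]; split; auto.
  have Ug : valid (U, g).
    split => /=.
    - have [inf1 _ _] := svalP s1; apply: sub_infinite_set inf1.
      by move=> x s1x; exists s1.
    - move=> p /U2/[apply] -[s [As p1 p2]]; exists s => //.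
      by rewrite -(gP _ _ As)//; have [_ + _] := svalP s; apply.
    - move=> p q Up1 Up2 Uq1 Uq2.
      have [s [As p1 p2]] := U2 _ _ Up1 Up2; have [t [At q1 q2]] := U2 _ _ Uq1 Uq2.
      rewrite -(gP _ _ As)// -(gP _ _ At)//.
      have [_ _ sinj] := svalP s; have [_ _ tinj] := svalP t.
      have [[st stE]|[ts tsE]] := totE _ _ As At.
        by rewrite stE//; apply: tinj => //; exact: st.
      by rewrite tsE//; apply: sinj => //; exact: ts.
  exists (exist _ _ Ug) => s As; apply/asboolP; split => /=.
    by move=> x sx; exists s.
  by move=> p; exact: gP.
exists (sval m); first exact: svalP.
move=> t tP mt.
have /mmax/asboolP[] : R m (exist _ t tP) by apply/asboolP.
by [].
Qed.

(** Take a maximal [(A, f)]. If the complement of [A] injects into [A], so does [K], and [f]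
    finishes; otherwise [(A, f)] has a proper extension. *)
Lemma card_le_setM_infinite : [set: K * K] #<= [set: K].
Proof.
have [[A f] [/= Ainf fA finj] Amax] := valid_maximal.
have [a1 [a2 [Aa1 Aa2 a12]]] := infinite_set_pair _ _ Ainf.
(* A set that injects into [A] still does so once [A] is adjoined to it:
   send [A] and its complement to [f (a1, _)] and [f (a2, _)]. *)
have absorb (C : set K) (h : K -> K) : (forall x, C x -> A (h x)) ->
    (forall x y, C x -> C y -> h x = h y -> x = y) ->
    exists e : K -> K, (forall x, A x \/ C x -> A (e x)) /\
      (forall x y, A x \/ C x -> A y \/ C y -> e x = e y -> x = y).
  move=> hA hinj.
  exists (fun x => if pselect (A x) then f (a1, x) else f (a2, h x)).
  split=> [x|x y]; case: pselect => Ax ACx.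
  - exact: fA.
  - by apply: fA => //; apply: hA; case: ACx.
  - case: pselect => Ay ACy /finj; first by move=> /(_ Aa1 Ax Aa1 Ay)[].
    have Ahy : A (h y) by apply: hA; case: ACy.
    by move=> /(_ Aa1 Ax Aa2 Ahy)[/a12].
  - have Ahx : A (h x) by apply: hA; case: ACx.
    case: pselect => Ay ACy /finj.
      by move=> /(_ Aa2 Ahx Aa1 Ay)[/esym/a12].
    have Ahy : A (h y) by apply: hA; case: ACy.
    move=> /(_ Aa2 Ahx Aa2 Ahy)[]; apply: hinj; first by case: ACx.
    by case: ACy.
have [] := card_le_total _ _ (~` A) A => /(card_le_inj _ _ _ _ a1)[h [hA hinj]].
  have [e [eA einj]] := absorb _ _ hA hinj.
  have AC x : A x \/ (~` A) x by exact: EM.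
  apply: (@inj_card_leT _ _ (fun p => f (e p.1, e p.2))) => -[x y] [x' y'] /=.
  have eAC z : A (e z) by exact: eA.
  move=> /(finj (_, _) (_, _) (eAC _) (eAC _) (eAC _) (eAC _))[].
  by move=> /(einj _ _ (AC _) (AC _)) -> /(einj _ _ (AC _) (AC _)) ->.
(* Otherwise a copy [h @` A] of [A] outside [A] leaves room for extending [f]
   to the square of [A `|` h @` A]. *)
have : forall y, exists x, (h @` A) y -> A x /\ h x = y.
  move=> z; have [[x Ax hxz]|nhz] := pselect ((h @` A) z); first by exists x.
  by exists z.
move=> /choice[r rP].
have [||e [eA einj]] := absorb (h @` A) r.
- by move=> y /rP[].
- by move=> x y /rP[_ hx] /rP[_ hy] rxy; rewrite -hx -hy rxy.
(* New pairs are coded in [A] by [e] and [f], then moved by [h] outside [A], away from the old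
   values. *)
pose g p := if pselect (A p.1 /\ A p.2) then f p else h (f (e p.1, e p.2)).
have gval : valid (A `|` h @` A, g).
  split => /=.
  - by apply: sub_infinite_set Ainf; left.
  - move=> p p1 p2; rewrite /g; case: pselect => /= [[Ap1 Ap2]|_].
      by left; exact: fA.
    by right; exists (f (e p.1, e p.2)) => //; apply: fA; exact: eA.
  - move=> p q p1 p2 q1 q2; rewrite /g.
    have Ae p' : (A `|` h @` A) p'.1 -> (A `|` h @` A) p'.2 -> A (f (e p'.1, e p'.2)).
      by move=> ? ?; apply: fA; exact: eA.
    case: pselect => /= [[Ap1 Ap2]|_]; case: pselect => /= [[Aq1 Aq2]|_].
    + exact: finj.
    + by move=> E; case: (hA _ (Ae _ q1 q2)); rewrite -E; exact: fA.
    + by move=> E; case: (hA _ (Ae _ p1 p2)); rewrite E; exact: fA.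
    + move=> /hinj-/(_ (Ae _ p1 p2) (Ae _ q1 q2)).
      move=> /(finj (_, _) (_, _) (eA _ p1) (eA _ p2) (eA _ q1) (eA _ q2))[].
      move=> /(einj _ _ p1 q1) pq1 /(einj _ _ p2 q2) pq2.
      by rewrite (surjective_pairing p) pq1 pq2 -surjective_pairing.
have ext : extends (A, f) (A `|` h @` A, g).
  split=> /= [|p p1 p2]; first by left.
  by rewrite /g; case: pselect => // np; case: np.
case: (hA _ Aa1).
apply: (Amax _ gval ext) => /=.
by right; exists a1.
Qed.

End infinite_square.

(** * Bounds on tightness without the minimum *)

(** The minimum is attained among the infinite subsets of [K] satisfying [P]: any competitor [M] is
    above [K] or equipotent to such a subset. *)
Lemma min_infinite_cardinal_leP (P : Type -> Prop) (K : Type) :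
  (forall M N : Type, [set: M] #<= [set: N] -> P M -> P N) ->
  infinite_set [set: K] ->
  (exists t, is_min_infinite_cardinal P t /\ [set: t] #<= [set: K]) <-> P K.
Proof.
move=> Pmono Kinf; split=> [[t [[_ Pt _] tK]]|PK]; first exact: Pmono Pt.
have PT (T : Type) (A : set T) (N : Type) :
    [set: N] #= A -> P N -> P (set_type A).
  move=> NA; apply: Pmono; rewrite (card_le_eqr (card_setT A)).
  by move: NA => /card_eqPle[].
pose I := {A : set K | infinite_set A /\ P (set_type A)}.
have I0 : I.
  exists setT; split=> //; exact: (PT _ _ K).
have [[A [Ainf PA]] /= Amin] := @card_le_family_min I I0 (fun i => set_type (sval i)).
have AK : [set: A] #<= [set: K].
  by rewrite (card_le_eql (card_setT A)); exact: card_leT.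
exists (set_type A); split=> //; split=> // [|M Minf PM].
  by apply/infiniteP; rewrite (card_le_eqr (card_setT A)); exact/infiniteP.
have [MK|KM] := card_le_total _ _ [set: M] [set: K]; last exact: card_le_trans KM.
have /card_subP[C CM _] := MK.
have Cinf : infinite_set C.
  by apply/infiniteP; rewrite (card_le_eqr CM); exact/infiniteP.
have PC : P (set_type C) by apply: PT PM; exact: card_esym.
have := Amin (exist _ C (conj Cinf PC)).
by rewrite /= (card_le_eqr (card_setT C)) (card_le_eqr CM).
Qed.

Lemma card_closure_sub (K : Type) (X : topologicalType) (A : set X) :
  card_closure K A `<=` closure A.
Proof. by move=> x [B [/closureS BA _]] /BA. Qed.

(** [Q] allows all sets for tightness and the open ones for boundary tightness. *)
Lemma closure_eq_card_closure_mono (X : topologicalType) (Q : set X -> Prop)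
    (M N : Type) :
  [set: M] #<= [set: N] ->
  (forall A, Q A -> closure A = card_closure M A) ->
  forall A, Q A -> closure A = card_closure N A.
Proof.
move=> MN QM A QA; apply/seteqP; split; last exact: card_closure_sub.
rewrite QM// => x [B [BA BM Bx]]; exists B; split=> //; exact: card_le_trans MN.
Qed.

Lemma tightness_leP (X : topologicalType) (K : Type) : infinite_set [set: K] ->
  tightness_le X K <-> forall A : set X, closure A = card_closure K A.
Proof.
move=> Kinf; apply: (min_infinite_cardinal_leP _ K) => // M N MN XM A.
apply: (closure_eq_card_closure_mono X (fun=> True) M) => // B _; exact: XM.
Qed.

Lemma boundary_tightness_leP (X : topologicalType) (K : Type) :
  infinite_set [set: K] ->
  boundary_tightness_le X K <->
  forall U : set X, open U -> closure U = card_closure K U.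
Proof.
move=> Kinf; apply: (min_infinite_cardinal_leP _ K) => // M N.
exact: closure_eq_card_closure_mono.
Qed.

(** * Small unions, iterated [K]-closure and lifting *)

(** Enumerations of [D] and of each [F i] by [K] map [K * K] onto a set containing the union. *)
Lemma card_le_bigcup_infinite (K I T : Type) (D : set I) (F : I -> set T) :
  infinite_set [set: K] -> D #<= [set: K] ->
  (forall i, D i -> F i #<= [set: K]) -> \bigcup_(i in D) F i #<= [set: K].
Proof.
move=> Kinf /pfcard_geP DK FK.
case: DK => [->|[d]]; first by rewrite bigcup_set0; exact: card_ge0.
have [[i0 [t0 [Di0 Ft0]]]|F0] := pselect (exists i t, D i /\ F i t); last first.
  suff -> : \bigcup_(i in D) F i = set0 by exact: card_ge0.
  by rewrite -subset0 => t [i Di Ft]; apply: F0; exists i, t.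
have : forall i, exists g : K -> T, D i -> F i `<=` range g.
  move=> i; have [Di|nDi] := pselect (D i); last by exists (fun=> t0).
  have /pfcard_geP[->|[g]] := FK _ Di; first by exists (fun=> t0) => _ ?.
  by exists g => _; exact: (@surj _ _ _ _ g).
move=> /choice[g gP].
apply: (card_le_trans _ (card_le_setM_infinite K Kinf)).
apply: (card_le_trans _ (card_image_le (fun p => g (d p.1) p.2) setT)).
apply: subset_card_le => t [i Di Ft].
have [k _ dk] := @surj _ _ _ _ d _ Di.
by have [l _ gl] := gP _ Di _ Ft; exists (k, l) => //=; rewrite dk.
Qed.

(** Replace each point of a small [B] by a small subset of [A] having it in its closure; the union
    of these is still small. *)
Lemma card_closure_idem (K : Type) (X : topologicalType) (A : set X) :
  infinite_set [set: K] -> card_closure K (card_closure K A) = card_closure K A.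
Proof.
move=> Kinf; apply/seteqP; split=> [x [B [BA BK Bx]]|x [B [BA BK Bx]]]; last first.
  exists B; split=> // b Bb; exists B; split=> //; exact: subset_closure.
have : forall b, exists C, B b -> [/\ C `<=` A, C #<= [set: K] & closure C b].
  by move=> b; have [/BA[C ?]|nBb] := pselect (B b); [exists C|exists set0].
move=> /choice[C CP]; exists (\bigcup_(b in B) C b); split.
- by move=> y [b /CP[CA _ _]] /CA.
- by apply: card_le_bigcup_infinite => // b /CP[].
  have /closure_id -> := @closed_closure _ (\bigcup_(b in B) C b).
  apply: closureS Bx => b Bb.
  have [_ _] := CP _ Bb; apply: closureS => y Cy; exists b => //.
Qed.

Lemma card_le_image_lift (K S T : Type) (f : S -> T) (A : set S) (B : set T) :
  B #<= [set: K] -> B `<=` f @` A ->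
  exists C : set S, [/\ C `<=` A, C #<= [set: K] & f @` C = B].
Proof.
move=> BK BfA.
have [g gP] : {g : B -> S | forall b, A (g b) /\ f (g b) = set_val b}.
  apply: cid; have : forall b : B, exists s, A s /\ f s = set_val b.
    by move=> b; have [s As fs] := BfA _ (set_valP b); exists s.
  by move=> /choice[g gP]; exists g.
exists (range g); split.
- by move=> _ [b _ <-]; case: (gP b).
- apply: (card_le_trans (card_image_le _ _)).
  by rewrite (card_le_eql (card_setT B)).
- apply/seteqP; split=> [_ [_ [b _ <-] <-]|t Bt].
    by have [_ ->] := gP b; exact: set_valP.
  exists (g (SigSub (mem_set Bt))); first by exists (SigSub (mem_set Bt)).
  by have [_ ->] := gP (SigSub (mem_set Bt)).
Qed.

(** * Closures in the product *)

(** Tube lemma: if the closure misses the fibre over [y], compactness gives one neighbourhood of [y]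
    whose whole tube misses [A]. *)
Lemma compact_closure_snd (X Y : topologicalType) (A : set (X * Y)) (y : Y) :
  compact [set: X] -> closure (snd @` A) y -> exists x, closure A (x, y).
Proof.
move=> /compact_near_coveringP Xcpt Ay; apply: contrapT => /forallNP nA.
have N : \forall y' \near nbhs y, [set: X] `<=` (fun x' => ~ A (x', y')).
  apply: (Xcpt Y (nbhs y) (fun y' x' => ~ A (x', y'))) => x _.
  have : ~ closure A (x, y) by exact: nA.
  move=> /existsNP[W /not_implyP[Wxy WA]].
  apply: filterS Wxy => -[x' y'] /= Wp Ap; apply: WA.
  by exists (x', y').
have [_ [[[x' y'] Ap <-] Np]] := Ay _ N.
exact: (Np x').
Qed.

Lemma closure_slice_sub (X Y : topologicalType) (A : set (X * Y)) (y : Y) :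
  closure [set x | A (x, y)] `<=` [set x | closure A (x, y)].
Proof.
move=> x Ax W [[P Q] /= [Px Qy] PQW].
have [x' [Ax' Px']] := Ax _ Px; exists (x', y); split=> //.
by apply: PQW; split=> //=; exact: nbhs_singleton.
Qed.

(** By tightness, a limit of the slice is a limit of at most [K] of its points, hence lies in the
    twice iterated [K]-closure of [A]. *)
Lemma card_closure_slice_closed (K : Type) (X Y : topologicalType)
    (A : set (X * Y)) (y : Y) :
  infinite_set [set: K] ->
  (forall B : set X, closure B = card_closure K B) ->
  closed [set x | card_closure K A (x, y)].
Proof.
move=> Kinf clX x; rewrite clX => -[B [BA BK Bx]] /=.
rewrite -card_closure_idem//; exists ((fun b => (b, y)) @` B); split.
- by move=> _ [b /BA ? <-].
- exact: card_le_trans (card_image_le _ _) BK.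
- by apply: closure_slice_sub; apply: closureS Bx => b Bb; exists b.
Qed.

Theorem theorem4p1 (K : Type) (X Y : topologicalType)
  (Kinfinite : infinite_set [set: K])
  (Xcompact : compact [set: X]) (Xhausdorff : hausdorff_space X)
  (Ytychonoff : tychonoff_space Y)
  (tX : tightness_le X K) (tbY : boundary_tightness_le Y K) :
  boundary_tightness_le (X * Y)%type K.
Proof.
have clX := (tightness_leP _ _ Kinfinite).1 tX.
have clY := (boundary_tightness_leP _ _ Kinfinite).1 tbY.
apply/boundary_tightness_leP => // U Uopen.
apply/seteqP; split=> [[x0 y0] Uxy|]; last exact: card_closure_sub.
pose G := [set x | card_closure K U (x, y0)].
have Gclosed : closed G by exact: card_closure_slice_closed.
apply: contrapT => nGx0.
(* Compact Hausdorff spaces are regular. *)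
have [V Vx0 VG] : filter_from (nbhs x0) closure (~` G).
  have : {for x0, @regular_space X} by exact: compact_regular Xcompact filterT.
  by apply; apply: open_nbhs_nbhs; split=> //; exact: closed_openC.
pose UV := U `&` (V° `*` setT).
have UVy0 : closure (snd @` UV) y0.
  move=> N Ny0.
  have [[x y] [Uxy1 [/= Vx Ny]]] : U `&` (V° `*` N) !=set0.
    by apply: Uxy; exists (V°, N) => //; split=> //; exact: nbhs_interior.
  by exists y; split=> //; exists (x, y).
have Wopen : open (snd @` UV).
  rewrite openE => _ [[x y] UVxy <-] /=.
  have : nbhs (x, y) UV.
    have [Uxy1 [/= Vx _]] := UVxy.
    apply: filterI; first by apply: open_nbhs_nbhs.
    exists (V°, setT) => //; split=> /=; last exact: filterT.
    by apply: open_nbhs_nbhs; split=> //; exact: open_interior.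
  move=> [[P Q] /= [Px Qy] PQ]; apply: filterS Qy => y' Qy'.
  by exists (x, y') => //; apply: PQ; split=> //=; exact: nbhs_singleton.
move: UVy0; rewrite clY// => -[B [BW BK By0]].
have [C [CUV CK CB]] := card_le_image_lift _ _ _ _ _ _ BK BW.
have [x Cx] : exists x, closure C (x, y0).
  by apply: compact_closure_snd => //; rewrite CB.
(* [C] itself witnesses that [x] is in [G]; what remains is [closure V x]. *)
apply: (VG x); last by exists C; split=> // p /CUV[].
move=> N Nx; have [|p [/CUV[_ [/interior_subset Vp _]] [/= Np _]]] := Cx (N `*` setT).
  by exists (N, setT) => //; split=> //; exact: filterT.
by exists p.1.
Qed.
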